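(* Let $k$ be a field. For every non-increasing function $f\colon \mathbb{N}_{\ge1} \to \mathbb{N}$ there exist a polynomial ring $R$ over $k$ and a monomial ideal $Q\subset R$ such that $\operatorname{depth} R/Q^n = f(n)$ for all $n \ge 1$.
   Context: Depth is taken with respect to the maximal homogeneous ideal of $R$ (standard grading). *)

(* Defs.v *)
From HB Require Import structures.
From mathcomp Require Import all_boot all_order all_algebra.
From mathcomp Require Import mpoly.
Set Implicit Arguments. Unset Strict Implicit. Unset Printing Implicit Defensive.
Import GRing.Theory.
Local Open Scope ring_scope.

Definition ideal_gen (R : comPzRingType) (S : R -> Prop) : R -> Prop :=
  fun p => exists s : seq (R * R),
    (forall c, c \in s -> S c.2) /\ p = \sum_(c <- s) c.1 * c.2.

Definition ideal_pow (R : comPzRingType) (I : R -> Prop) (n : nat) : R -> Prop :=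
  ideal_gen (fun p => exists s : seq R,
    size s = n /\ (forall x, x \in s -> I x) /\ p = \prod_(x <- s) x).

Definition monom (m : nat) := 'X_{1.. m}.

Definition monomial_ideal (k : fieldType) (m : nat) (G : seq (monom m))
  : {mpoly k[m]} -> Prop :=
  ideal_gen (fun p => exists mu, mu \in G /\ p = 'X_[mu]).

Definition max_homog_ideal (k : fieldType) (m : nat) : {mpoly k[m]} -> Prop :=
  ideal_gen (fun p => exists i : 'I_m, p = 'X_i).

Definition ideal_add_seq (R : comPzRingType) (J : R -> Prop) (s : seq R) : R -> Prop :=
  ideal_gen (fun p => J p \/ p \in s).

Definition regular_seq (k : fieldType) (m : nat) (J : {mpoly k[m]} -> Prop)
  (s : seq {mpoly k[m]}) : Prop :=
  (forall i, (i < size s)%N -> max_homog_ideal (nth 0 s i)) /\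
  (forall i, (i < size s)%N -> forall p,
      ideal_add_seq J (take i s) (nth 0 s i * p) -> ideal_add_seq J (take i s) p) /\
  ~ ideal_add_seq J s 1.

Definition depth_quot_eq (k : fieldType) (m : nat) (J : {mpoly k[m]} -> Prop)
  (d : nat) : Prop :=
  (exists s, size s = d /\ regular_seq J s) /\
  (forall s, regular_seq J s -> (size s <= d)%N).

(* Main.v *)
Require Import Defs.
From HB Require Import structures.
From mathcomp Require Import all_boot all_order all_algebra.
From mathcomp Require Import mpoly.
From mathcomp Require Import ring zify.
From Stdlib Require Import Classical FunctionalExtensionality PropExtensionality.

(** Put D = f(1) and, for l < D, let t_l be the least n with f(n) <= l, or 1 if there is none.
    In the variables x, y_l, z_l (l < D) take Q = x * prod_l (x^t_l, x y_l^(t_l-2) z_l, y_l^(t_l-1) z_l),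
    with the factor (x, z_l) when t_l = 1.  Call l free at n if n < t_l or t_l = 1; exactly f(n)
    indices are free at n.

    The elements y_l - z_l, l free at n, form a regular sequence on R/Q^n: identifying z_l with y_l
    for some of the free l turns Q^n into another monomial ideal, and for a monomial ideal whose
    exponent set is closed under meets in the coordinates y_j, z_j the element y_j - z_j is regular.

    Conversely a monomial u outside Q^n is multiplied into Q^n by every variable except the y_l with
    l free.  If there were a regular sequence of more than f(n) elements, their q-th powers would
    satisfy a polynomial relation g(a^q) u = 0 modulo Q^n, by counting monomials; this forces
    u into Q^n + (a^q) for every q, which fails once q > deg u. *)

Set Implicit Arguments.
Unset Strict Implicit.
Unset Printing Implicit Defensive.
Import GRing.Theory.
Local Open Scope ring_scope.

(** * Ideals as predicates and weakly regular sequences *)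

Section Ideals.
Variable R : comPzRingType.
Implicit Types (I J : R -> Prop) (s : seq R).

Definition is_ideal J :=
  [/\ J 0, forall p q, J p -> J q -> J (p + q) & forall r p, J p -> J (r * p)].

Lemma ideal_sum J (T : Type) (r : seq T) (P : pred T) (F : T -> R) :
  is_ideal J -> (forall i, P i -> J (F i)) -> J (\sum_(i <- r | P i) F i).
Proof. by case=> J0 JD _ JF; elim/big_ind: _. Qed.

Lemma ideal_opp J p : is_ideal J -> J p -> J (- p).
Proof. by case=> _ _ JM /(JM (-1)); rewrite mulN1r. Qed.

Lemma ideal_sub J p q : is_ideal J -> J p -> J q -> J (p - q).
Proof. by move=> iJ; case: (iJ) => _ JD _ Jp Jq; apply: JD => //; apply: ideal_opp. Qed.

Lemma ideal_gen_ideal (S : R -> Prop) : is_ideal (ideal_gen S).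
Proof.
split.
- by exists [::]; rewrite big_nil.
- move=> _ _ [s [Ss ->]] [t [St ->]]; exists (s ++ t); rewrite big_cat; split=> // c.
  by rewrite mem_cat => /orP[/Ss|/St].
- move=> r _ [s [Ss ->]]; exists [seq (r * c.1, c.2) | c <- s]; split.
    by move=> c /mapP[d /Ss Sd ->].
  by rewrite big_map mulr_sumr; apply: eq_bigr => c _; rewrite mulrA.
Qed.

Lemma ideal_gen_incl (S : R -> Prop) p : S p -> ideal_gen S p.
Proof.
move=> Sp; exists [:: (1, p)]; rewrite big_seq1 mul1r; split=> // c.
by rewrite inE => /eqP->.
Qed.

Lemma ideal_gen_min (S J : R -> Prop) p :
  is_ideal J -> (forall q, S q -> J q) -> ideal_gen S p -> J p.
Proof.
move=> iJ SJ [s [Ss ->]]; rewrite big_seq; apply: ideal_sum => // c /Ss /SJ.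
by case: iJ => _ _ JM /JM.
Qed.

(** $J + (a)$ with the cofactor of [a] explicit, so that elements can be absorbed into the ideal one
    at a time. *)
Definition adjoin J a : R -> Prop := fun p => exists r, J (p - r * a).

Lemma adjoin_ideal J a : is_ideal J -> is_ideal (adjoin J a).
Proof.
move=> [J0 JD JM]; split.
- by exists 0; rewrite mul0r subr0.
- move=> p q [r Jr] [t Jt]; exists (r + t).
  by rewrite [X in J X](_ : _ = (p - r * a) + (q - t * a)); [apply: JD | ring].
- move=> t p [r Jr]; exists (t * r).
  by rewrite [X in J X](_ : _ = t * (p - r * a)); [apply: JM | ring].
Qed.

Lemma adjoin_incl J a p : J p -> adjoin J a p.
Proof. by move=> Jp; exists 0; rewrite mul0r subr0. Qed.

Lemma adjoin_gen J a : is_ideal J -> adjoin J a a.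
Proof. by case=> J0 _ _; exists 1; rewrite mul1r subrr. Qed.

Lemma adjoin_min I J a p :
  is_ideal J -> (forall q, I q -> J q) -> J a -> adjoin I a p -> J p.
Proof.
case=> _ JD JM IJ Ja [r /IJ Jr].
by rewrite -[p](subrK (r * a)); apply: JD => //; apply: JM.
Qed.

Lemma ideal_add_nil J p : is_ideal J -> ideal_add_seq J [::] p <-> J p.
Proof.
move=> iJ; split; first by apply: ideal_gen_min => // q [].
by move=> Jp; apply: ideal_gen_incl; left.
Qed.

Lemma ideal_add_cons J a s p : is_ideal J ->
  ideal_add_seq J (a :: s) p <-> ideal_add_seq (adjoin J a) s p.
Proof.
move=> iJ; split; apply: ideal_gen_min; try exact: ideal_gen_ideal.
  move=> q [Jq|]; first by apply: ideal_gen_incl; left; apply: adjoin_incl.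
  rewrite inE => /predU1P[->|qs]; apply: ideal_gen_incl; last by right.
  by left; apply: adjoin_gen.
move=> q [|qs]; last by apply: ideal_gen_incl; right; rewrite inE qs orbT.
apply: adjoin_min; first exact: ideal_gen_ideal.
  by move=> x Jx; apply: ideal_gen_incl; left.
by apply: ideal_gen_incl; right; rewrite mem_head.
Qed.

(** Weakly regular sequences in the usual sense: the final quotient may vanish. The recursion
    enlarges the ideal instead of keeping a prefix, which suits induction on the sequence. *)
Fixpoint weakly_regular J s : Prop :=
  if s is a :: s' then
    (forall p, J (a * p) -> J p) /\ weakly_regular (adjoin J a) s'
  else True.

Lemma weakly_regular_ext I J s :
  (forall p, I p <-> J p) -> weakly_regular I s -> weakly_regular J s.
Proof.
elim: s I J => //= a s IHs I J eIJ [Ia Is]; split.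
  by move=> p /eIJ /Ia /eIJ.
apply: IHs Is => p; split; case=> r /eIJ Jr; by exists r.
Qed.

Lemma weakly_regularP J s : is_ideal J ->
  (forall i, (i < size s)%N -> forall p,
     ideal_add_seq J (take i s) (nth 0 s i * p) -> ideal_add_seq J (take i s) p) ->
  weakly_regular J s.
Proof.
elim: s J => //= a s IHs J iJ reg; split.
  by move=> p Jp; apply/(ideal_add_nil _ iJ)/(reg 0%N isT)/ideal_add_nil.
apply: IHs => [|i si p]; first exact: adjoin_ideal.
move=> aJ; apply/(ideal_add_cons _ _ _ iJ); apply: (reg i.+1) => //=.
exact/ideal_add_cons.
Qed.

Definition colon J a : R -> Prop := fun p => J (a * p).

(* The extension property for 0 -> R/(J : a) -> R/J -> R/(J + a) -> 0. *)
Lemma weakly_regular_extension J a s : is_ideal J ->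
  weakly_regular (colon J a) s -> weakly_regular (adjoin J a) s -> weakly_regular J s.
Proof.
elim: s J => //= b s IHs J iJ [cb cs] [ab as_].
have [J0 JD JM] := iJ.
split.
  move=> p Jbp; have [r Jr] := ab p (adjoin_incl a Jbp).
  have /cb cr : colon J a (b * r).
    rewrite /colon [X in J X](_ : _ = b * p - b * (p - r * a)); last by ring.
    by apply: ideal_sub => //; apply: JM.
  by rewrite -[p](subrK (r * a)) [r * a]mulrC; apply: JD => //; rewrite mulrC.
apply: IHs; first exact: adjoin_ideal.
  apply: weakly_regular_ext cs => p; split.
    case=> r cr; exists (a * r).
    by rewrite [X in J X](_ : _ = a * (p - r * b)); [|ring].
  (* From $ap \equiv wb$ modulo [J], regularity of [b] modulo $J + (a)$ gives $w \equiv va$, and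
     then $a(p - vb) \in J$. *)
  case=> w Jw.
  have [v Jv] : adjoin J a w.
    apply: ab; exists p.
    rewrite [X in J X](_ : _ = - (a * p - w * b)); last by ring.
    exact: ideal_opp.
  exists v; rewrite /colon.
  rewrite [X in J X](_ : _ = (a * p - w * b) + b * (w - v * a)); last by ring.
  by apply: JD => //; apply: JM.
apply: weakly_regular_ext as_ => p; split.
  case=> r [t Jt]; exists t; exists r.
  by rewrite addrAC.
case=> r [t Jt]; exists t; exists r.
by rewrite addrAC.
Qed.

(** Induction on [q]: the colon of $J + (a^{q+1})$ by [a] is $J + (a^q)$, because [a] is regular,
    and adjoining [a] gives $J + (a)$, so the extension property applies. *)
Lemma weakly_regular_adjoin_exp J a s q : is_ideal J ->
  weakly_regular J (a :: s) -> weakly_regular (adjoin J (a ^+ q)) s.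
Proof.
move=> iJ /= [Ja Js]; have [J0 JD JM] := iJ.
elim: q => [|q IHq].
  have JT p : adjoin J (a ^+ 0) p by exists p; rewrite mulr1 subrr.
  have iJ0 : is_ideal (adjoin J (a ^+ 0)) by apply: adjoin_ideal.
  elim: s {Js} (adjoin J (a ^+ 0)) JT iJ0 => //= b s IHs K KT iK; split=> //.
  by apply: IHs => [p|]; [apply: adjoin_incl | apply: adjoin_ideal].
apply: (@weakly_regular_extension _ a); first exact: adjoin_ideal.
  apply: weakly_regular_ext IHq => p; rewrite /colon; split; case=> r Jr; exists r.
    rewrite [X in J X](_ : _ = a * (p - r * a ^+ q)); first exact: JM.
    by rewrite exprS; ring.
  apply: Ja; rewrite [X in J X](_ : _ = a * p - r * a ^+ q.+1) //.
  by rewrite exprS; ring.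
apply: weakly_regular_ext Js => p; split.
  case=> r Jr; exists r; exact: adjoin_incl.
case=> r [t Jt]; exists (r + t * a ^+ q).
by rewrite [X in J X](_ : _ = p - r * a - t * a ^+ q.+1) // exprS; ring.
Qed.

Lemma weakly_regular_exp J s q : is_ideal J ->
  weakly_regular J s -> weakly_regular J [seq a ^+ q | a <- s].
Proof.
elim: s J => //= a s IHs J iJ ws; split.
  move=> p; case: ws => Ja _.
  by elim: {IHs} q => [|q IHq]; rewrite ?mul1r // exprS -mulrA => /Ja.
apply: IHs; first exact: adjoin_ideal.
exact: (@weakly_regular_adjoin_exp J a s q).
Qed.

End Ideals.

(** * Polynomial relations in a weakly regular sequence *)

Fixpoint box (N r : nat) : seq (seq nat) :=
  if r is r'.+1 then [seq i :: e | i <- iota 0 N, e <- box N r'] else [:: [::]].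

Lemma size_box N r : size (box N r) = (N ^ r)%N.
Proof. by elim: r => //= r IHr; rewrite size_allpairs size_iota IHr expnS. Qed.

Lemma box_uniq N r : uniq (box N r).
Proof.
elim: r => //= r IHr; apply: allpairs_uniq => //; first exact: iota_uniq.
by move=> [i e] [j g] _ _ [-> ->].
Qed.

Lemma mem_box_cons N r i e :
  (i :: e \in box N r.+1) = (i < N)%N && (e \in box N r).
Proof.
apply/allpairsP/andP => [[[j g] /= [jN gb [-> ->]]]|[iN eb]].
  by move: jN; rewrite mem_iota add0n.
by exists (i, e); rewrite mem_iota.
Qed.

Fixpoint expo (R : pzRingType) (s : seq R) (e : seq nat) : R :=
  if s is a :: s' then a ^+ head 0%N e * expo s' (behead e) else 1.

Section PolynomialRelations.
Variables (k : fieldType) (R : comAlgType k).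
Implicit Types (J : R -> Prop) (s : seq R).

(* A nonzero polynomial relation g(s) u = 0 in R/J: at each step divide by the largest
   power of the head of s and then reduce modulo the head. *)
Lemma relation_ideal_add J s N (c : seq nat -> k) u : is_ideal J ->
  weakly_regular J s -> J ((\sum_(e <- box N (size s)) c e *: expo s e) * u) ->
  (exists2 e, e \in box N (size s) & c e != 0) -> ideal_add_seq J s u.
Proof.
elim: s J c => [|a s IHs] J c iJ.
  rewrite /= big_seq1 => _ Jc [e]; rewrite inE => /eqP-> c0.
  apply/ideal_add_nil => //; case: (iJ) => _ _ JM.
  have := JM ((c [::])^-1%:A) _ Jc.
  by rewrite -scalerAl mul1r scalerAl scalerA mulVf // scale1r mul1r.
move=> /= [Ja Js]; rewrite big_allpairs_dep => Jc nz.
apply: NNPP => nu.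
have [J0 JD JM] := iJ.
pose G i := \sum_(e <- box N (size s)) c (i :: e) *: expo s e.
have cE i : \sum_(e <- box N (size s)) c (i :: e) *: (a ^+ i * expo s e) = a ^+ i * G i.
  by rewrite mulr_sumr; apply: eq_bigr => e _; rewrite scalerAr.
have {}Jc : J ((\sum_(0 <= i < N) a ^+ i * G i) * u).
  by move: Jc; rewrite /index_iota subn0; under eq_bigr => i _ do rewrite /= cE.
(* With [u] outside the ideal all coefficients vanish, layer by layer in the exponent of [a]: once
   the layers below [n] are zero, $a^n$ cancels and layer [n] becomes a relation in [s] modulo
   [a]. *)
suff H n : (n <= N)%N -> forall i, (i < n)%N -> forall e, e \in box N (size s) -> c (i :: e) = 0.
  case: nz => -[|i e]; first by case/allpairsP => p [].
  by rewrite mem_box_cons => /andP[iN eb] /eqP; apply; apply: (H N).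
elim: n => // n IHn nN i.
rewrite ltnS leq_eqVlt => /predU1P[->|/IHn]; last by apply; apply: ltnW.
have {}IHn := IHn (ltnW nN).
have G0 j : (j < n)%N -> G j = 0.
  by move=> jn; rewrite /G big_seq big1 // => e eb; rewrite IHn // scale0r.
have JGn : adjoin J a (G n * u).
  have : J (a ^+ n * ((\sum_(n <= j < N) a ^+ (j - n) * G j) * u)).
    rewrite mulrA mulr_sumr; move: Jc; rewrite (big_cat_nat (leq0n n) (ltnW nN)) /=.
    rewrite big_nat big1 ?add0r; last by move=> j /= jn; rewrite G0 ?mulr0.
    rewrite big_nat [X in _ -> J (X * _)]big_nat.
    under eq_bigr => j /andP[nj _] do rewrite -{1}(subnKC nj) exprD -mulrA.
    by [].
  have ann : forall q p, J (a ^+ q * p) -> J p.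
    by elim=> [|q IHq] p; [rewrite mul1r | rewrite exprS -mulrA => /Ja /IHq].
  move/ann; rewrite big_ltn // subnn mul1r => JG.
  exists (- (\sum_(n.+1 <= j < N) a ^+ (j - n.+1) * G j) * u).
  rewrite [X in J X](_ : _ = (G n + \sum_(n.+1 <= j < N) a ^+ (j - n) * G j) * u) //.
  rewrite (_ : \sum_(n.+1 <= j < N) a ^+ (j - n) * G j =
    a * \sum_(n.+1 <= j < N) a ^+ (j - n.+1) * G j); first by ring.
  rewrite mulr_sumr big_nat [RHS]big_nat; apply: eq_bigr => j /andP[nj _].
  by rewrite mulrA -exprS subnSK.
move=> e eb; apply/eqP; apply: contra_notT nu => ce.
apply/ideal_add_cons => //; apply: (IHs _ (fun e => c (n :: e))) => //.
  exact: adjoin_ideal.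
by exists e.
Qed.
End PolynomialRelations.

(** * Monomial ideals as sets of exponents, and the upper bound on depth *)

Section MonomialIdeals.
Variables (k : fieldType) (m : nat).
Implicit Types (P : 'X_{1..m} -> Prop) (p q : {mpoly k[m]}) (u v w : 'X_{1..m}).

(** For an up-closed [P] this is the monomial ideal with exponent set [P]; membership is decided one
    monomial at a time. *)
Definition supp_ideal P p := forall u, u \in msupp p -> P u.

Definition up_closed P := forall u v, P u -> P (u + v)%MM.

Lemma up_closed_le P u v : up_closed P -> (u <= v)%MM -> P u -> P v.
Proof. by move=> uP /submK <- Pu; rewrite addmC; apply: uP. Qed.

Lemma supp_idealX P u : supp_ideal P 'X_[u] <-> P u.
Proof.
split; first by apply; rewrite msuppX mem_head.
by move=> Pu v; rewrite msuppX inE => /eqP->.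
Qed.

Lemma supp_ideal_ideal P : up_closed P -> is_ideal (supp_ideal P).
Proof.
move=> uP; split.
- by move=> u; rewrite msupp0.
- by move=> p q Pp Pq u /msuppD_le; rewrite mem_cat => /orP[/Pp|/Pq].
- move=> r p Pp u /msuppM_le /allpairsP[[v w] /= [_ /Pp Pw ->]].
  by rewrite addmC; apply: uP.
Qed.

Lemma supp_ideal_sub P (J : {mpoly k[m]} -> Prop) p : is_ideal J ->
  (forall u, P u -> J 'X_[u]) -> supp_ideal P p -> J p.
Proof.
move=> iJ PJ Pp; rewrite [p]mpolyE big_seq; apply: ideal_sum => // u /Pp /PJ.
by case: iJ => _ _ JM Ju; rewrite -mul_mpolyC; apply: JM.
Qed.

Lemma supp_ideal_degM (q1 q2 : nat) p1 p2 :
  supp_ideal (fun u => (q1 <= mdeg u)%N) p1 -> supp_ideal (fun u => (q2 <= mdeg u)%N) p2 ->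
  supp_ideal (fun u => (q1 + q2 <= mdeg u)%N) (p1 * p2).
Proof.
move=> s1 s2 u /msuppM_le /allpairsP[[v w] /= [/s1 v1 /s2 w2 ->]].
by rewrite mdegD leq_add.
Qed.

Lemma supp_ideal_degX p (q : nat) :
  supp_ideal (fun u => (1 <= mdeg u)%N) p -> supp_ideal (fun u => (q <= mdeg u)%N) (p ^+ q).
Proof.
move=> s1; elim: q => [|q IHq] //; rewrite exprS -add1n.
exact: supp_ideal_degM.
Qed.

Lemma max_homog_idealE p :
  max_homog_ideal p <-> supp_ideal (fun u => (1 <= mdeg u)%N) p.
Proof.
split.
  apply: ideal_gen_min.
    by apply: supp_ideal_ideal => u v u1; rewrite mdegD (leq_trans u1) ?leq_addr.
  by move=> _ [i ->]; apply/supp_idealX; rewrite mdeg1.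
apply: supp_ideal_sub; first exact: ideal_gen_ideal.
move=> u; case: (pickP (fun i => u i != 0%N)) => [i ui _|u0].
  have /submK <- : (U_(i) <= u)%MM by rewrite lep1mP.
  rewrite mpolyXD; have [_ _ JM] := ideal_gen_ideal (fun p => exists i : 'I_m, p = 'X_i :> {mpoly k[m]}).
  by apply: JM; apply: ideal_gen_incl; exists i.
rewrite mdegE big1 // => i _; apply/eqP; move: (u0 i) => /=.
by case: eqP.
Qed.

(** [msize] is the degree plus one, and 0 at the zero polynomial, which therefore satisfies every
    bound. *)
Definition deg_le p (d : nat) := (msize p <= d.+1)%N.

Lemma deg_leM p q (d e : nat) : deg_le p d -> deg_le q e -> deg_le (p * q) (d + e).
Proof.
rewrite /deg_le; have [->|p0] := eqVneq p 0; first by rewrite mul0r msize0.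
have [->|q0] := eqVneq q 0; first by rewrite mulr0 msize0.
by rewrite msizeM // => pd qe; rewrite -subn1 leq_subLR add1n -addSn -addnS leq_add.
Qed.

Lemma deg_leX p d e : deg_le p d -> deg_le (p ^+ e) (d * e).
Proof.
move=> pd; elim: e => [|e IHe]; first by rewrite muln0 /deg_le expr0 msize1.
by rewrite exprS mulnS; apply: deg_leM.
Qed.

Lemma deg_le_expo s d N e : (forall p, p \in s -> deg_le p d) -> e \in box N (size s) ->
  deg_le (expo s e) (size s * (d * N)).
Proof.
elim: s e => [|p s IHs] e sd; first by rewrite /deg_le msize1.
case: e => [|i e]; first by case/allpairsP => ? [].
rewrite mem_box_cons /= => /andP[iN eb]; rewrite mulSn; apply: deg_leM.
  apply: leq_trans (deg_leX i (sd p (mem_head _ _))) _.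
  by rewrite ltnS leq_mul2l ltnW // orbT.
by apply: IHs => // q qs; apply: sd; rewrite inE qs orbT.
Qed.

(* Only the monomials in the variables Z matter modulo the annihilator of 'X_[mu]; there are
   fewer of them of bounded degree than monomials in more than #|Z| elements of bounded degree. *)
Lemma exists_relation (Z : seq 'I_m) (s : seq {mpoly k[m]}) (d : nat) :
  (size Z < size s)%N -> (forall p, p \in s -> deg_le p d) ->
  exists N (c : seq nat -> k),
    (exists2 e, e \in box N (size s) & c e != 0) /\
    forall u, u \in msupp (\sum_(e <- box N (size s)) c e *: expo s e) ->
      exists2 i, i \notin Z & u i != 0%N.
Proof.
set z := size Z; set r := size s => zr sd.
(* This choice gives $K^z \le (rd+1)^z N^z < N^{z+1} \le N^r$: the box has more elements than there
   are monomials in the variables of [Z] with exponents below [K]. *)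
pose N := ((r * d).+1 ^ z).+1.
pose K := (r * (d * N)).+1.
have cardlt : (K ^ z < N ^ r)%N.
  have KN : (K <= (r * d).+1 * N)%N by rewrite /K; lia.
  have KNz : (K ^ z <= ((r * d).+1 * N) ^ z)%N.
    by case: (z) => // z'; rewrite leq_exp2r.
  apply: leq_ltn_trans KNz _; rewrite expnMn.
  have Nz : (0 < N ^ z)%N by rewrite expn_gt0.
  apply: leq_trans (_ : N * N ^ z <= _)%N; first by rewrite ltn_pmul2r.
  by rewrite -expnS leq_pexp2l.
pose T := {ffun 'I_z -> 'I_K}.
pose dec (j : T) : 'X_{1..m} :=
  [multinom (if insub (index i Z) is Some l then j l : nat else 0%N) | i < m].
pose B := box N r.
(* Rows are the products [expo s e], columns the exponents supported on [Z]; a nonzero vector of the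
   left kernel is a combination in which all these monomials cancel. *)
pose M : 'M[k]_(size B, #|T|) :=
  \matrix_(a, b) (expo s (nth [::] B a))@_(dec (enum_val b)).
have : kermx M != 0.
  rewrite -mxrank_eq0 mxrank_ker subn_eq0 -ltnNge.
  apply: leq_ltn_trans (rank_leq_col M) _.
  by rewrite card_ffun !card_ord size_box.
case/rowV0Pn => v /sub_kermxP vM vn0.
have [a va] : exists a, v 0 a != 0.
  by case/rV0Pn: vn0 => a va; exists a.
pose c e := if insub (index e B) is Some a then v 0 a else 0.
have cE (b : 'I_(size B)) : c (nth [::] B b) = v 0 b.
  rewrite /c index_uniq ?box_uniq //; case: insubP => [b' _ bb|]; last by rewrite ltn_ord.
  by congr (v 0 _); apply: val_inj.
exists N, c; split; first by exists (nth [::] B a); rewrite ?cE // mem_nth.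
set g := \sum_(e <- _) _ => u ug.
apply: NNPP => nu.
have uZ i : i \notin Z -> u i = 0%N.
  by move=> iZ; apply/eqP/negPn/negP => ui; apply: nu; exists i.
have gd : deg_le g (r * (d * N)).
  rewrite /g big_seq /deg_le; apply: (big_ind (fun p => msize p <= K)%N).
  - by rewrite msize0.
  - by move=> p q pK qK; apply: leq_trans (msizeD_le _ _) _; rewrite geq_max pK.
  - by move=> e eb; apply: leq_trans (msizeZ_le _ _) _; apply: deg_le_expo.
have uK i : (u i < K)%N.
  apply: leq_ltn_trans (leq_trans (msize_mdeg_lt ug) gd).
  by rewrite mdegE (bigD1 i) //= leq_addr.
pose j : T := [ffun l => Ordinal (uK (tnth (in_tuple Z) l))].
have uj : u = dec j.
  apply/mnmP => i; rewrite mnmE; case: insubP => [l lz li|].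
    by rewrite ffunE /= (tnth_nth i) /= li nth_index // -index_mem.
  by rewrite index_mem => /uZ.
move: ug; rewrite mcoeff_msupp /g => /negP; apply; apply/eqP.
transitivity ((v *m M) 0 (enum_rank j)); last by rewrite vM mxE.
rewrite mxE raddf_sum (big_nth [::]) big_mkord; apply: eq_bigr => b _.
by rewrite /= mcoeffZ cE mxE enum_rankK uj.
Qed.

(** Every monomial of the relation from [exists_relation] contains a variable outside [Z], hence
    sends ['X_[mu]] into [supp_ideal P]. Then [relation_ideal_add] puts ['X_[mu]] into the ideal
    generated by [supp_ideal P] and the [q]-th powers, although its degree is below [q]. *)
Theorem weakly_regular_size_le P mu (Z : seq 'I_m) (s : seq {mpoly k[m]}) :
  up_closed P -> ~ P mu -> (forall i, i \notin Z -> P (mu + U_(i))%MM) ->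
  weakly_regular (supp_ideal P) s -> (forall p, p \in s -> max_homog_ideal p) ->
  (size s <= size Z)%N.
Proof.
move=> uP Pmu PZ ws sm; rewrite leqNgt; apply/negP => zs.
have iP := supp_ideal_ideal uP.
pose q := (mdeg mu).+1.
pose t := [seq p ^+ q | p <- s].
have wt : weakly_regular (supp_ideal P) t by apply: weakly_regular_exp.
have st : size t = size s by rewrite size_map.
pose d := \max_(p <- t) msize p.
have td p : p \in t -> deg_le p d.
  by move=> pt; rewrite /deg_le ltnW // ltnS /d (leq_bigmax_seq (F := fun p : {mpoly k[m]} => msize p)).
have [] := @exists_relation Z t d _ td; first by rewrite st.
move=> N [c [nz gZ]].
have : ideal_add_seq (supp_ideal P) t 'X_[mu].
  apply: relation_ideal_add nz => // u /msuppM_le /allpairsP[[v w] /= [/gZ]].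
  case=> i iZ vi; rewrite msuppX inE => /eqP-> ->.
  apply: (@up_closed_le _ (mu + U_(i))%MM) => //; last exact: PZ.
  apply/mnm_lepP => l; rewrite !mnmDE mnm1E addnC leq_add2r.
  by case: eqP => [<-|_] //; rewrite lt0n.
(* [P'] covers both [P] and every monomial of a [q]-th power of an element without constant term,
   yet misses [mu]. *)
move=> tmu; pose P' u := P u \/ (q <= mdeg u)%N.
have : supp_ideal P' 'X_[mu].
  apply: ideal_gen_min tmu.
    apply: supp_ideal_ideal => u v [a|b]; first by left; apply: uP.
    by right; rewrite mdegD (leq_trans b) ?leq_addr.
  move=> p [Pp u /Pp|]; first by left.
  case/mapP => a /sm /max_homog_idealE am -> u /(supp_ideal_degX am); by right.
by case/supp_idealX => //; rewrite /q ltnn.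
Qed.

End MonomialIdeals.

(** * Regularity of a difference of two variables *)

Section DifferenceOfVariables.
Variables (k : fieldType) (m : nat).
Implicit Types (P : 'X_{1..m} -> Prop) (p q : {mpoly k[m]}) (u v w : 'X_{1..m}).

(** The coefficient of the product at $u + e_y$ vanishes, so [p] has equal coefficients at $u$ and
    $u + e_y - e_z$. Repeating this lowers the exponent of [z] until it would become negative. *)
Lemma subX_coef_chase P y z p u : y != z -> up_closed P ->
  supp_ideal P (p * ('X_y - 'X_z)) ->
  (forall i, ~ P (u + U_(y) *+ i)%MM) -> u \notin msupp p.
Proof.
move=> yz uP Pyz; move: {2}(u z) (erefl (u z)) => n.
elim: n u => [|n IHn] u uz nP; rewrite mcoeff_msupp negbK; apply/eqP.
  have : (p * ('X_y - 'X_z))@_(U_(y) + u) = 0.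
    apply: memN_msupp_eq0; apply/negP => /Pyz; rewrite addmC.
    by have := nP 1%N; rewrite mulm1n.
  rewrite mulrBr mcoeffB mcoeffMX => /eqP; rewrite subr_eq0 => /eqP->.
  apply: memN_msupp_eq0; rewrite (perm_mem (msuppMX _ _)).
  apply/mapP => -[v _ /(congr1 (fun w : 'X_{1..m} => w z))].
  by rewrite !mnmDE !mnm1E uz eqxx (negbTE yz).
have zu : (U_(z) <= u)%MM by rewrite lep1mP uz.
pose v := (u - U_(z))%MM.
have uE : u = (v + U_(z))%MM by rewrite submK.
have : (p * ('X_y - 'X_z))@_(U_(y) + u) = 0.
  apply: memN_msupp_eq0; apply/negP => /Pyz; rewrite addmC.
  by have := nP 1%N; rewrite mulm1n.
rewrite mulrBr mcoeffB mcoeffMX => /eqP; rewrite subr_eq0 => /eqP->.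
rewrite {1}uE addmA [(U_(y) + v)%MM]addmC addmC mcoeffMX.
apply: memN_msupp_eq0; apply: IHn => [|i Pi].
  by rewrite mnmDE mnm1E (negbTE yz) addn0 /v mnmBE mnm1E eqxx uz subn1.
apply: (nP i.+1).
rewrite [X in P X](_ : _ = (v + U_(y) + U_(y) *+ i + U_(z))%MM); first exact: uP.
by apply/mnmP => l; rewrite {1}uE mulmS !mnmDE; lia.
Qed.

(** For $u$ outside [P] the meet condition keeps one of the rays $u + i e_y$, $u + j e_z$ entirely
    outside [P], and the coefficient chase runs along that ray. *)
Lemma subX_regular P y z p : y != z -> up_closed P ->
  (forall v i j, P (v + U_(y) *+ i)%MM -> P (v + U_(z) *+ j)%MM -> P v) ->
  supp_ideal P (('X_y - 'X_z) * p) -> supp_ideal P p.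
Proof.
move=> yz uP meetP; rewrite mulrC => Pyz u up; apply: NNPP => nPu.
have Pzy : supp_ideal P (p * ('X_z - 'X_y)).
  have iP := supp_ideal_ideal k uP.
  by rewrite -opprB mulrN; apply: (ideal_opp iP).
case: (classic (exists i, P (u + U_(y) *+ i)%MM)) => [[i Pi]|ny].
  case: (classic (exists j, P (u + U_(z) *+ j)%MM)) => [[j Pj]|nz].
    exact: nPu (meetP _ _ _ Pi Pj).
  have zy : z != y by rewrite eq_sym.
  by move: up; apply/negP/(subX_coef_chase zy uP Pzy) => j Pj; apply: nz; exists j.
by move: up; apply/negP/(subX_coef_chase yz uP Pyz) => j Pj; apply: ny; exists j.
Qed.

(** * Identifying variables along an idempotent map *)

Section Merge.
Variable g : 'I_m -> 'I_m.
Hypothesis gg : forall i, g (g i) = g i.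

Definition merge_mnm w : 'X_{1..m} := (\sum_(i < m) U_(g i) *+ w i)%MM.

Definition merge (p : {mpoly k[m]}) : {mpoly k[m]} := p \mPo [tuple 'X_(g i) | i < m].

Lemma merge_mnmD u v : merge_mnm (u + v) = (merge_mnm u + merge_mnm v)%MM.
Proof.
rewrite /merge_mnm -big_split; apply: eq_bigr => i _.
by apply/mnmP => j; rewrite !mnmDE !mulmnE mulnDr.
Qed.

Lemma merge_mnmU i n : merge_mnm (U_(i) *+ n) = (U_(g i) *+ n)%MM.
Proof.
rewrite /merge_mnm (bigD1 i) //= big1 ?addm0.
  by rewrite mulmnE mnm1E eqxx mul1n.
by move=> j ji; rewrite mulmnE mnm1E eq_sym (negbTE ji) mul0n mulm0n.
Qed.

Lemma merge_mnm0 : merge_mnm 0 = 0%MM.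
Proof. by rewrite /merge_mnm big1 // => i _; rewrite mnm0E mulm0n. Qed.

Lemma merge_mnm_fix w i : (forall j, g j = i -> j = i) -> g i = i -> merge_mnm w i = w i.
Proof.
move=> gi gii; rewrite /merge_mnm mnm_sumE (bigD1 i) //= big1 ?addn0.
  by rewrite mulmnE mnm1E gii eqxx mul1n.
move=> j ji; rewrite mulmnE mnm1E; case: eqP => // /gi jE.
by rewrite jE eqxx in ji.
Qed.

Lemma merge_mnmK w : merge_mnm (merge_mnm w) = merge_mnm w.
Proof.
rewrite {2}/merge_mnm (big_morph _ merge_mnmD merge_mnm0).
by apply: eq_bigr => i _; rewrite merge_mnmU gg.
Qed.

Lemma mergeX w : merge 'X_[w] = 'X_[merge_mnm w].
Proof.
rewrite /merge comp_mpolyX /merge_mnm (big_morph _ (mpolyXD k) (mpolyX0 _ k)); apply: eq_bigr => i _.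
by rewrite tnth_mktuple mpolyXn.
Qed.

Definition merge_pred P v := exists2 w, P w & merge_mnm w = merge_mnm v.

Lemma merge_pred_up P : up_closed P -> up_closed (merge_pred P).
Proof.
move=> uP u v [w Pw wE]; exists (w + v)%MM; first exact: uP.
by rewrite !merge_mnmD wE.
Qed.

(** For an up-closed [P] this is the ideal generated by [supp_ideal P] and all $X_i - X_{g(i)}$,
    written as the preimage of a monomial ideal under the substitution. *)
Definition merge_ideal P p := supp_ideal (merge_pred P) (merge p).

Lemma merge_ideal_ideal P : up_closed P -> is_ideal (merge_ideal P).
Proof.
move=> /merge_pred_up /(supp_ideal_ideal k) [J0 JD JM]; split.
- by rewrite /merge_ideal /merge rmorph0.
- by move=> p q Jp Jq; rewrite /merge_ideal /merge rmorphD; apply: JD.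
- by move=> r p Jp; rewrite /merge_ideal /merge rmorphM; apply: JM.
Qed.

Lemma merge_ideal_incl P p : up_closed P -> supp_ideal P p -> merge_ideal P p.
Proof.
move=> uP; apply: supp_ideal_sub; first exact: merge_ideal_ideal.
move=> u Pu; rewrite /merge_ideal mergeX; apply/supp_idealX.
by exists u; rewrite ?merge_mnmK.
Qed.

Lemma sub_mergeX_mem (J : {mpoly k[m]} -> Prop) w : is_ideal J ->
  (forall i, J ('X_i - 'X_(g i))) -> J ('X_[w] - 'X_[merge_mnm w]).
Proof.
move=> iJ Jg; have [J0 JD JM] := iJ.
rewrite (mpolyXE_id k w) -mergeX {1}/merge comp_mpolyX.
elim/big_rec2: _ => [|i p q _ Jqp]; first by rewrite subrr.
rewrite tnth_mktuple.
have Jn n : J ('X_i ^+ n - 'X_(g i) ^+ n).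
  rewrite subrXX; apply: (_ : forall a b, J a -> J (a * b)) (Jg i).
  by move=> a b Ja; rewrite mulrC; apply: JM.
rewrite [X in J X](_ : _ = 'X_i ^+ w i * (q - p) + p * ('X_i ^+ w i - 'X_(g i) ^+ w i)).
  by apply: JD; apply: JM.
by ring.
Qed.

Lemma merge_ideal_min P (J : {mpoly k[m]} -> Prop) p : is_ideal J ->
  (forall q, supp_ideal P q -> J q) -> (forall i, J ('X_i - 'X_(g i))) ->
  merge_ideal P p -> J p.
Proof.
move=> iJ PJ Jg Pp; have [J0 JD JM] := iJ.
rewrite -[p](subrK (merge p)); apply: (JD).
  rewrite {1}[p]mpolyE /merge comp_mpolyEX -sumrB; apply: ideal_sum => // u _.
  rewrite -scalerBr -mul_mpolyC; apply: JM.
  by have := sub_mergeX_mem u iJ Jg; rewrite -mergeX.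
apply: supp_ideal_sub Pp => // v [w Pw wv].
rewrite -['X_[v]](subrK 'X_[merge_mnm v]); apply: (JD); first exact: sub_mergeX_mem.
rewrite -wv -['X_[_]](subrK 'X_[w]); apply: (JD); last exact/PJ/supp_idealX.
by rewrite -opprB; apply: ideal_opp => //; apply: sub_mergeX_mem.
Qed.

End Merge.

(** * Regular sequences of differences $y_l - z_l$ *)

Section DifferenceSequence.
Variables (D : nat) (x : 'I_m) (y z : 'I_D -> 'I_m) (P : 'X_{1..m} -> Prop).
Hypotheses (y_inj : injective y) (z_inj : injective z).
Hypotheses (yz : forall i j, y i != z j) (xy : forall i, x != y i) (xz : forall i, x != z i).
Hypothesis uP : up_closed P.

Definition yz_meet l := forall w1 w2 i j, P w1 -> P w2 -> w1 x = w2 x ->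
  w1 (y l) = (w2 (y l) + i)%N -> w2 (z l) = (w1 (z l) + j)%N ->
  (exists2 w, P w & w1 = w + U_(y l) *+ i)%MM \/ (exists2 w, P w & w2 = w + U_(z l) *+ j)%MM.

Definition z_to_y (A : seq 'I_D) (i : 'I_m) : 'I_m :=
  if [pick l in A | z l == i] is Some l then y l else i.

Lemma z_to_y_z A l : z_to_y A (z l) = if l \in A then y l else z l.
Proof.
rewrite /z_to_y; case: pickP => [j /andP[jA /eqP /z_inj <-]|/(_ l)]; first by rewrite jA.
by rewrite eqxx andbT => ->.
Qed.

Lemma z_to_y_id A i : (forall l, z l != i) -> z_to_y A i = i.
Proof. by move=> zi; rewrite /z_to_y; case: pickP => // l; rewrite (negbTE (zi l)) andbF. Qed.

Lemma z_to_yP A i : (exists2 l, l \in A & i = z l /\ z_to_y A i = y l) \/ z_to_y A i = i.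
Proof.
rewrite /z_to_y; case: pickP => [l /andP[lA /eqP <-]|_]; last by right.
by left; exists l.
Qed.

Lemma z_to_yK A i : z_to_y A (z_to_y A i) = z_to_y A i.
Proof.
case: (z_to_yP A i) => [[l _ [_ ->]]|gi]; last by rewrite !gi.
apply: z_to_y_id => j.
by rewrite eq_sym.
Qed.

(** As [l] is not in [A], merging leaves the coordinates [x], [y l] and [z l] unchanged. The lifts
    thus satisfy the premises of [yz_meet], and cancelling the removed variable leaves a lift of
    [v]. *)
Lemma merge_pred_yz_meet A l v i j : l \notin A -> yz_meet l ->
  merge_pred (z_to_y A) P (v + U_(y l) *+ i)%MM ->
  merge_pred (z_to_y A) P (v + U_(z l) *+ j)%MM ->
  merge_pred (z_to_y A) P v.
Proof.
move=> lA meet [w1 P1 E1] [w2 P2 E2].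
have gy : z_to_y A (y l) = y l by apply: z_to_y_id => j'; rewrite eq_sym.
have gz : z_to_y A (z l) = z l by rewrite z_to_y_z (negbTE lA).
have gx : z_to_y A x = x by apply: z_to_y_id => j'; rewrite eq_sym.
have fy w : merge_mnm (z_to_y A) w (y l) = w (y l).
  apply: merge_mnm_fix => // i'; case: (z_to_yP A i') => [[l' l'A [_ ->]]|->] //.
  by move=> /y_inj ll'; rewrite -ll' l'A in lA.
have fz w : merge_mnm (z_to_y A) w (z l) = w (z l).
  apply: merge_mnm_fix => // i'; case: (z_to_yP A i') => [[l' _ [_ ->]]|->] //.
  by move=> /eqP; rewrite (negbTE (yz _ _)).
have fx w : merge_mnm (z_to_y A) w x = w x.
  apply: merge_mnm_fix => // i'; case: (z_to_yP A i') => [[l' _ [_ ->]]|->] //.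
  by move=> /eqP; rewrite eq_sym (negbTE (xy _)).
have at_ w w' a : merge_mnm (z_to_y A) w = merge_mnm (z_to_y A) w' ->
  merge_mnm (z_to_y A) w a = merge_mnm (z_to_y A) w' a by move->.
have x1 : w1 x = v x.
  by have := at_ _ _ x E1; rewrite !fx mnmDE mulmnE mnm1E eq_sym (negbTE (xy _)) addn0.
have x2 : w2 x = v x.
  by have := at_ _ _ x E2; rewrite !fx mnmDE mulmnE mnm1E eq_sym (negbTE (xz _)) addn0.
have y1 : w1 (y l) = (v (y l) + i)%N.
  by have := at_ _ _ (y l) E1; rewrite !fy mnmDE mulmnE mnm1E eqxx mul1n.
have y2 : w2 (y l) = v (y l).
  by have := at_ _ _ (y l) E2; rewrite !fy mnmDE mulmnE mnm1E eq_sym (negbTE (yz _ _)) addn0.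
have z1 : w1 (z l) = v (z l).
  by have := at_ _ _ (z l) E1; rewrite !fz mnmDE mulmnE mnm1E (negbTE (yz _ _)) addn0.
have z2 : w2 (z l) = (v (z l) + j)%N.
  by have := at_ _ _ (z l) E2; rewrite !fz mnmDE mulmnE mnm1E eqxx mul1n.
case: (meet w1 w2 i j) => //; try congruence.
  case=> w Pw wE; exists w => //; move: E1.
  by rewrite wE !merge_mnmD => /addIm.
case=> w Pw wE; exists w => //; move: E2.
by rewrite wE !merge_mnmD => /addIm.
Qed.

Definition differences (T : seq 'I_D) : seq {mpoly k[m]} := [seq 'X_(y l) - 'X_(z l) | l <- T].

(** Modulo the differences indexed by [A] the quotient is again monomial, in the variables left
    after replacing [z l] by [y l]; the next difference is tested there. *)
Lemma ideal_add_differences A p :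
  ideal_add_seq (supp_ideal P) (differences A) p <-> merge_ideal (z_to_y A) P p.
Proof.
have iA : is_ideal (ideal_add_seq (supp_ideal P) (differences A)) by apply: ideal_gen_ideal.
split.
  apply: ideal_gen_min; first exact: merge_ideal_ideal.
  move=> q [|/mapP[l lA ->]]; first by apply: merge_ideal_incl => //; apply: z_to_yK.
  rewrite /merge_ideal /merge rmorphB /= !comp_mpolyXU -!tnth_nth !tnth_mktuple.
  rewrite z_to_y_z lA z_to_y_id ?subrr; last by move=> j; rewrite eq_sym.
  by move=> u; rewrite msupp0.
apply: merge_ideal_min => //.
  by move=> q Pq; apply: ideal_gen_incl; left.
move=> i; case: (z_to_yP A i) => [[l lA [-> ->]]|->].
  rewrite -opprB; apply: ideal_opp => //; apply: ideal_gen_incl; right.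
  by apply/mapP; exists l.
by rewrite subrr; case: iA.
Qed.

Theorem regular_differences (T : seq 'I_D) : uniq T ->
  (forall l, l \in T -> yz_meet l) -> (forall w, w x = 0%N -> ~ P w) ->
  regular_seq (supp_ideal P) (differences T).
Proof.
move=> uT meetT Px.
have szT : size (differences T) = size T by rewrite size_map.
split; last split.
- move=> i; rewrite szT => iT; apply/max_homog_idealE.
  case: T iT {uT meetT szT} => // l0 T iT; rewrite (nth_map l0) //.
  have iM : is_ideal (supp_ideal (k := k) (fun u : 'X_{1..m} => (1 <= mdeg u)%N)).
    by apply: supp_ideal_ideal => u v u1; rewrite mdegD (leq_trans u1) ?leq_addr.
  by apply: (ideal_sub iM); apply/supp_idealX; rewrite mdeg1.
- move=> i; rewrite szT => iT p.
  have [l0 _] : {l0 : 'I_D | true} by case: T iT {uT meetT szT} => // l0; exists l0.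
  rewrite -map_take (nth_map l0) // => /ideal_add_differences Lp.
  apply/ideal_add_differences; move: Lp; set A := take i T; set l := nth l0 T i.
  have lA : l \notin A.
    move: uT; rewrite -(cat_take_drop i T) cat_uniq (drop_nth l0) // => /and3P[_ /hasPn].
    by move=> /(_ l); rewrite mem_head => /(_ isT).
  have lT : l \in T by rewrite mem_nth.
  rewrite /merge_ideal {1}/merge rmorphM rmorphB /= !comp_mpolyXU -!tnth_nth !tnth_mktuple.
  rewrite z_to_y_z (negbTE lA) z_to_y_id; last by move=> j; rewrite eq_sym.
  apply: subX_regular => //; first exact: merge_pred_up.
  by move=> v i1 j1; apply: merge_pred_yz_meet => //; apply: meetT.
(* If 1 were in the ideal, some exponent in [P] would merge to 0; merging preserves the exponent of
   [x], which would then be 0. *)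
move=> /ideal_add_differences; rewrite /merge_ideal /merge rmorph1 -mpolyX0.
case/supp_idealX => w Pw /(congr1 (fun u : 'X_{1..m} => u x)).
have gx : z_to_y T x = x by apply: z_to_y_id => j'; rewrite eq_sym.
rewrite merge_mnm0 mnm0E merge_mnm_fix //; first by move/Px.
move=> i'; case: (z_to_yP T i') => [[l' _ [_ ->]]|->] //.
by move=> /eqP; rewrite eq_sym (negbTE (xy _)).
Qed.

End DifferenceSequence.
End DifferenceOfVariables.

(** * Exponent sets of powers of a monomial ideal *)

Section PowersOfMonomialIdeals.
Variables (k : fieldType) (m : nat) (G : seq 'X_{1..m}).

Definition above_sum n (u : 'X_{1..m}) :=
  exists s : seq 'X_{1..m}, [/\ size s = n, {subset s <= G} & (\sum_(v <- s) v <= u)%MM].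

Lemma above_sum_up n : up_closed (above_sum n).
Proof.
move=> u v [s [sn sG su]]; exists s; split=> //.
by apply: lepm_trans su _; apply/mnm_lepP => i; rewrite mnmDE leq_addr.
Qed.

Lemma monomial_ideal_supp p : @monomial_ideal k m G p -> supp_ideal (above_sum 1) p.
Proof.
apply: ideal_gen_min; first exact/supp_ideal_ideal/above_sum_up.
move=> _ [v [vG ->]]; apply/supp_idealX; exists [:: v]; split=> //.
  by move=> w; rewrite inE => /eqP->.
by rewrite big_seq1 lepm_refl.
Qed.

Lemma supp_ideal_above_sumM n n' p q :
  supp_ideal (above_sum n) p -> supp_ideal (above_sum n') q ->
  supp_ideal (above_sum (n + n')) (p * q : {mpoly k[m]}).
Proof.
move=> Pp Pq u /msuppM_le /allpairsP[[v w] /= [/Pp [s [sn sG su]] /Pq [s' [sn' sG' su']] ->]].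
exists (s ++ s'); split; first by rewrite size_cat sn sn'.
  by move=> a; rewrite mem_cat => /orP[/sG|/sG'].
rewrite big_cat; apply/mnm_lepP => i /=; rewrite !mnmDE.
by apply: leq_add; apply: (mnm_lepP _).
Qed.

(** An equality of predicates, by extensionality, so that depth statements can be rewritten along
    it. *)
Lemma monomial_ideal_pow n :
  ideal_pow (@monomial_ideal k m G) n = supp_ideal (above_sum n).
Proof.
apply: functional_extensionality => p; apply: propositional_extensionality; split.
  apply: ideal_gen_min; first exact/supp_ideal_ideal/above_sum_up.
  move=> _ [s [<- [sI ->]]]; elim: s sI => [|a s IHs] sI.
    rewrite big_nil -mpolyX0; apply/supp_idealX; exists [::]; split=> //.
    by rewrite big_nil lepm_refl.
  rewrite big_cons -[size _]add1n; apply: supp_ideal_above_sumM.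
    by apply/monomial_ideal_supp/sI/mem_head.
  by apply: IHs => b bs; apply: sI; rewrite inE bs orbT.
apply: supp_ideal_sub; first exact: ideal_gen_ideal.
move=> u [s [sn sG /submK <-]]; rewrite mpolyXD.
have [_ _ JM] := ideal_gen_ideal (fun p : {mpoly k[m]} => exists s : seq {mpoly k[m]},
    size s = n /\ (forall x, x \in s -> monomial_ideal G x) /\ p = \prod_(x <- s) x).
apply: JM; apply: ideal_gen_incl; exists [seq 'X_[v] | v <- s].
rewrite size_map; split=> //; split.
  by move=> _ /mapP[v /sG vG ->]; apply: ideal_gen_incl; exists v.
by rewrite big_map (big_morph _ (mpolyXD k) (mpolyX0 _ k)).
Qed.

End PowersOfMonomialIdeals.

(** * Arithmetic of a single block *)

(* [block_pow t n e b c] says that x^e y^b z^c lies in (x^t, x y^(t-2) z, y^(t-1) z)^n: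
   use j times the second generator and s - j times the third one. *)
Definition block_pow (t n e b c : nat) := exists s j,
  [/\ j <= s, s <= n, t * n + j <= e + t * s, t.-1 * s <= b + j & s <= c]%N.

Lemma block_pow_le t n e b c e' b' c' : (e <= e')%N -> (b <= b')%N -> (c <= c')%N ->
  block_pow t n e b c -> block_pow t n e' b' c'.
Proof. by move=> ee bb cc [s [j [h1 h2 h3 h4 h5]]]; exists s, j; split=> //; lia. Qed.

(** The value 1 stands for a threshold that is never reached. *)
Definition free_at t n := (n < t)%N || (t == 1%N).

(** If $s_2 \le c$ the second witness works. Otherwise $s_1 < s_2$, and lowering $s$ by one saves $t
    - 1$ in the exponent of $y$, at least what $j_2 \le n < t$ contributes; so the first witness
    works. For $t = 1$ the exponent of $y$ is unconstrained. *)
Lemma block_pow_meet t n e b c i j : (0 < t)%N -> free_at t n ->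
  block_pow t n e (b + i) c -> block_pow t n e b (c + j) -> block_pow t n e b c.
Proof.
move=> t0 tn [s1 [j1 [h1 h2 h3 h4 h5]]] [s2 [j2 [g1 g2 g3 g4 g5]]].
case/orP: tn => [nt|/eqP t1]; last first.
  by subst t; exists s1, j1; split=> //; lia.
have [s2c|cs2] := leqP s2 c; first by exists s2, j2.
exists s1, j1; split=> //.
case: t t0 nt h3 h4 g3 g4 => // t _ nt h3 h4 g3 g4; rewrite /= in h4 g4 *.
by nia.
Qed.

Lemma block_pow_socle t n : (0 < t)%N -> (0 < n)%N -> exists abc : nat * nat * nat,
  let: (a, b, c) := abc in
  [/\ block_pow t n a.+1 b c, forall e, block_pow t n e b c -> (a < e)%N,
      block_pow t n a b c.+1 & ~~ free_at t n -> block_pow t n a b.+1 c].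
Proof.
move=> t0 n0; have [inT|notT] := boolP (free_at t n).
  have tn0 : (0 < t * n)%N by rewrite muln_gt0 t0.
  (* Without $z$ only powers of $x^t$ are available, and one $x$ is missing; one $z$ permits a
     single $y^{t-1} z$ in place of $x^t$. *)
  exists ((t * n).-1, t.-1, 0)%N; split=> //.
  - by exists 0%N, 0%N; rewrite muln0 addn0; split=> //; lia.
  - by move=> e [s [j [h1 h2 h3 h4 h5]]]; have s0 : s = 0%N; [lia | subst s; lia].
  - by exists 1%N, 0%N; rewrite !muln1 !addn0; split=> //; lia.
have {notT} [t2 tn] : (2 <= t /\ t <= n)%N by move: notT; rewrite /free_at; lia.
(* One $y$ is missing for $x^t (y^{t-1} z)^{n-1}$. An extra $x$ trades one $y^{t-1} z$ for $x
   y^{t-2} z$; an extra $z$ permits $n$ factors with $z$, of which $t \le n$ are $x y^{t-2} z$. *)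
exists (t, ((n.-1) * t.-1).-1, n.-1)%N; split.
- by exists n.-1, 1%N; split; nia.
- move=> e [s [j [h1 h2 h3 h4 h5]]].
  have [sn|sn] := eqVneq s n.-1.
    subst s; have j0 : (0 < j)%N by nia.
    by nia.
  have sn2 : (s + 2 <= n)%N by lia.
  have : (t * (s + 2) <= t * n)%N by rewrite leq_mul2l sn2 orbT.
  by nia.
- by exists n, t; split=> //; nia.
- by move=> _; exists n.-1, 0%N; split=> //; nia.
Qed.

(** Exponents in the three generators of one factor. For $t = 1$ truncated subtraction yields $x,
    xz, z$, which generate $(x, z)$. *)
Definition xdeg (t : nat) (c : 'I_3) := if c == 0 :> nat then t else (c == 1 :> nat) : nat.
Definition ydeg (t : nat) (c : 'I_3) :=
  if c == 0 :> nat then 0%N else (t - (if c == 1 :> nat then 2 else 1))%N.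
Definition zdeg (c : 'I_3) : nat := c != 0 :> nat.

Lemma block_pow_sum t (cs : seq 'I_3) : (0 < t)%N ->
  block_pow t (size cs) (\sum_(c <- cs) xdeg t c) (\sum_(c <- cs) ydeg t c) (\sum_(c <- cs) zdeg c).
Proof.
move=> t0; elim: cs => [|c cs [s [j [h1 h2 h3 h4 h5]]]].
  by exists 0%N, 0%N; rewrite !big_nil /= !muln0; split.
rewrite !big_cons /=.
move: (\sum_(c <- cs) xdeg t c)%N h3 => X h3; move: (\sum_(c <- cs) ydeg t c)%N h4 => Y h4.
move: (\sum_(c <- cs) zdeg c)%N h5 => Z h5.
rewrite /xdeg /ydeg /zdeg; case: c => -[|[|[|//]]] /= _.
- by exists s, j; split=> //; nia.
- by exists s.+1, j.+1; split=> //; nia.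
- by exists s.+1, j; split=> //; nia.
Qed.

Lemma sum_ltn (n s : nat) : (s <= n)%N -> (\sum_(i < n) (i < s) = s)%N.
Proof.
move=> sn; rewrite -(big_mkord xpredT (fun i => (i < s : nat))) (big_cat_nat (leq0n s) sn) /=.
rewrite big_nat [X in (_ + X)%N]big_nat [X in (_ + X)%N]big1 ?addn0; last first.
  by move=> i /andP[si _]; rewrite ltnNge si.
under eq_bigr => i /andP[_ si] do rewrite si.
by rewrite -big_nat sum_nat_const_nat subn0 muln1.
Qed.

(** The first [j] positions take the second generator, the next [s - j] the third, the rest the
    first. *)
Lemma block_pow_choose t n e b c : (0 < t)%N -> block_pow t n e b c ->
  exists h : 'I_n -> 'I_3, [/\ \sum_(i < n) xdeg t (h i) <= e,
    \sum_(i < n) ydeg t (h i) <= b & \sum_(i < n) zdeg (h i) <= c]%N.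
Proof.
move=> t0 [s [j [js sn h3 h4 h5]]].
pose h (i : 'I_n) : 'I_3 := inord (if i < j then 1 else if i < s then 2 else 0)%N.
have hE (i : 'I_n) : h i = (if i < j then 1 else if i < s then 2 else 0)%N :> nat.
  by rewrite inordK //; case: ifP => // _; case: ifP.
have jn : (j <= n)%N by apply: leq_trans sn.
exists h; split.
- have : (\sum_(i < n) (xdeg t (h i) + t * (i < s)) = \sum_(i < n) (t + (i < j)))%N.
    apply: eq_bigr => i _; rewrite /xdeg hE.
    by case: (ltnP i j) => ij; case: (ltnP i s) => //= si; lia.
  rewrite !big_split /= -big_distrr /= !sum_ltn ?sum_nat_const ?card_ord //.
  by move: (\sum_(i < n) _)%N => X; nia.
(* The factor [1 < t] accounts for $t = 1$, where $t - 2$ and $t - 1$ both truncate to 0. *)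
- have : (\sum_(i < n) (ydeg t (h i) + (i < j) * (1 < t)) = \sum_(i < n) (t.-1 * (i < s)))%N.
    apply: eq_bigr => i _; rewrite /ydeg hE.
    by case: (ltnP i j) => ij; case: (ltnP i s) => //= si; lia.
  rewrite !big_split /= -big_distrr -big_distrl /= !sum_ltn //.
  by case: (ltnP 1 t) => tt; nia.
- apply: leq_trans h5; rewrite -[leqRHS](sum_ltn sn); apply: leq_sum => i _.
  rewrite /zdeg hE; case: (ltnP i j) => ij; case: (ltnP i s) => //= si; lia.
Qed.

(** * The ideal $Q$ and the depth of its powers *)

Section Construction.
Variables (k : fieldType) (D : nat) (t : 'I_D -> nat).
Hypothesis t_gt0 : forall l, (0 < t l)%N.

Local Notation m := ((D + D).+1).
Definition var_x : 'I_m := ord0.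
Definition var_y (l : 'I_D) : 'I_m := lift ord0 (lshift D l).
Definition var_z (l : 'I_D) : 'I_m := lift ord0 (rshift D l).

Lemma var_y_inj : injective var_y.
Proof. by move=> i j /lift_inj /lshift_inj. Qed.

Lemma var_z_inj : injective var_z.
Proof. by move=> i j /lift_inj /rshift_inj. Qed.

Lemma var_yz i j : var_y i != var_z j.
Proof. by rewrite (inj_eq lift_inj) eq_lrshift. Qed.

Variant var_spec : 'I_m -> Type :=
| VarX : var_spec var_x
| VarY l : var_spec (var_y l)
| VarZ l : var_spec (var_z l).

Lemma varP i : var_spec i.
Proof.
case: (unliftP ord0 i) => [j ->|->]; last exact: VarX.
by rewrite -[j]splitK; case: (split j) => l; [apply: VarY | apply: VarZ].
Qed.

Definition mnm_xyz (a : nat) (b c : 'I_D -> nat) : 'X_{1..m} :=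
  [multinom (if unlift ord0 i is Some j then
               match split j with inl l => b l | inr l => c l end
             else a) | i < m].

Lemma mnm_xyz_x a b c : mnm_xyz a b c var_x = a.
Proof. by rewrite mnmE unlift_none. Qed.

Lemma mnm_xyz_y a b c l : mnm_xyz a b c (var_y l) = b l.
Proof. by rewrite mnmE liftK (unsplitK (inl l)). Qed.

Lemma mnm_xyz_z a b c l : mnm_xyz a b c (var_z l) = c l.
Proof. by rewrite mnmE liftK (unsplitK (inr l)). Qed.

Definition mnm_xyzE := (mnm_xyz_x, mnm_xyz_y, mnm_xyz_z).

(* h l selects the generator x^t, x y^(t-2) z or y^(t-1) z of the l-th factor. *)
Definition generator (h : {ffun 'I_D -> 'I_3}) : 'X_{1..m} :=
  mnm_xyz (1 + \sum_l xdeg (t l) (h l)) (fun l => ydeg (t l) (h l)) (fun l => zdeg (h l)).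

Definition generators := [seq generator h | h : {ffun 'I_D -> 'I_3}].

(** The blocks share the variable [x]: [e l] is the part of its exponent spent on block [l], and the
    summand [n] pays for the leading [x] of each generator. *)
Definition power_pred n (u : 'X_{1..m}) := exists2 e : 'I_D -> nat,
  (n + \sum_l e l <= u var_x)%N &
  forall l, block_pow (t l) n (e l) (u (var_y l)) (u (var_z l)).

Lemma power_pred_up n : up_closed (power_pred n).
Proof.
move=> u v [e ex eB]; exists e; first by rewrite mnmDE (leq_trans ex) ?leq_addr.
by move=> l; apply: block_pow_le (eB l); rewrite ?mnmDE ?leq_addr.
Qed.

(** Generators range over all [h], so choices in different blocks are independent: [n] choices in
    each block assemble into [n] generators. *)
Lemma above_sumE n u : above_sum generators n u <-> power_pred n u.
Proof.
split.
  case=> s [sn sG su].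
  have [hs hE] : exists hs, s = [seq generator h | h <- hs].
    elim: s sG {sn su} => [|v s IHs] sG; first by exists [::].
    have /codomP[h ->] := sG v (mem_head _ _).
    case: IHs => [w ws|hs ->]; first by apply: sG; rewrite inE ws orbT.
    by exists (h :: hs).
  move: sn su; rewrite {s sG}hE size_map big_map => <- /mnm_lepP su.
  exists (fun l => \sum_(h <- hs) xdeg (t l) (h l))%N.
    apply: leq_trans (su var_x); rewrite mnm_sumE.
    under [leqRHS]eq_bigr => h _ do rewrite mnm_xyzE.
    by rewrite big_split /= sum1_size exchange_big.
  move=> l; have := block_pow_sum [seq h l | h : {ffun 'I_D -> 'I_3} <- hs] (t_gt0 l).
  rewrite !big_map size_map; apply: block_pow_le => //.
    apply: leq_trans (su (var_y l)); rewrite mnm_sumE.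
    by under [leqRHS]eq_bigr => h _ do rewrite mnm_xyzE.
  apply: leq_trans (su (var_z l)); rewrite mnm_sumE.
  by under [leqRHS]eq_bigr => h _ do rewrite mnm_xyzE.
case=> e ex eB.
have /fin_all_exists[H HP] l := block_pow_choose (t_gt0 l) (eB l).
pose h (i : 'I_n) : {ffun 'I_D -> 'I_3} := [ffun l => H l i].
exists [seq generator (h i) | i : 'I_n]; split.
- by rewrite size_map size_enum_ord.
- by move=> _ /codomP[i ->]; apply: codom_f.
rewrite big_image; apply/mnm_lepP => a; rewrite mnm_sumE.
case: (varP a) => [|l|l].
- apply: leq_trans ex; under eq_bigr => i _ do rewrite mnm_xyzE.
  rewrite big_split sum1_card card_ord leq_add2l /= exchange_big; apply: leq_sum => l _.
  by case: (HP l) => [+ _ _]; under eq_bigr => i _ do rewrite ffunE.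
- case: (HP l) => _ + _; apply: leq_trans.
  by rewrite leq_eqVlt; apply/orP; left; apply/eqP/eq_bigr => i _; rewrite mnm_xyzE ffunE.
- case: (HP l) => _ _; apply: leq_trans.
  by rewrite leq_eqVlt; apply/orP; left; apply/eqP/eq_bigr => i _; rewrite mnm_xyzE ffunE.
Qed.

Lemma generators_pow n :
  ideal_pow (@monomial_ideal k m generators) n = supp_ideal (power_pred n).
Proof.
rewrite monomial_ideal_pow; congr supp_ideal.
by apply: functional_extensionality => u; apply: propositional_extensionality; apply: above_sumE.
Qed.

Lemma subU_ex (w : 'X_{1..m}) i j : (j <= w i)%N -> exists2 w', w = (w' + U_(i) *+ j)%MM &
  (forall a, a != i -> w' a = w a) /\ w' i = (w i - j)%N.
Proof.
move=> jw; exists (w - U_(i) *+ j)%MM; last first.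
  split=> [a ai|]; rewrite mnmBE mulmnE mnm1E ?eqxx ?mul1n //.
  by rewrite eq_sym (negbTE ai) subn0.
apply/mnmP => a; rewrite mnmDE mnmBE mulmnE mnm1E.
by case: eqP => [<-|_]; rewrite ?mul1n ?mul0n; lia.
Qed.

(** The two witnesses may give block [l] different shares of [x]. The one with the larger share is
    kept; [block_pow] is monotone in the share, so [block_pow_meet] applies. *)
Lemma power_pred_meet n l : free_at (t l) n -> yz_meet var_x var_y var_z (power_pred n) l.
Proof.
move=> nl w1 w2 i j [e1 x1 B1] [e2 x2 B2] xx yy zz.
case: (leqP (e1 l) (e2 l)) => ee; [right | left].
  have [w wE [wo wz]] := @subU_ex w2 (var_z l) j ltac:(lia).
  exists w => //; exists e2; first by rewrite wo.
  move=> a; rewrite wo ?var_yz //.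
  have [->|al] := eqVneq a l; last by rewrite wo ?(inj_eq var_z_inj) //; apply: B2.
  rewrite wz zz addnK; apply: (block_pow_meet (i := i) (j := j)) => //.
    by rewrite -yy; apply: block_pow_le (B1 l).
  by rewrite -zz; apply: B2.
have [w wE [wo wy]] := @subU_ex w1 (var_y l) i ltac:(lia).
exists w => //; exists e1; first by rewrite wo.
move=> a; rewrite [w (var_z a)]wo; last by rewrite eq_sym var_yz.
have [->|al] := eqVneq a l; last by rewrite wo ?(inj_eq var_y_inj) //; apply: B1.
rewrite wy yy addnK; apply: (block_pow_meet (i := i) (j := j)) => //.
  by rewrite -yy; apply: B1.
by rewrite -zz; apply: block_pow_le (B2 l) => //; apply: ltnW.
Qed.

Definition free_blocks n := [seq l <- enum 'I_D | free_at (t l) n].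

Lemma power_pred_socle n : (0 < n)%N -> exists2 mu, ~ power_pred n mu &
  forall i, i \notin [seq var_y l | l <- free_blocks n] -> power_pred n (mu + U_(i))%MM.
Proof.
move=> n0; have /fin_all_exists[f fP] l := block_pow_socle (t_gt0 l) n0.
pose a l := (f l).1.1; pose b l := (f l).1.2; pose c l := (f l).2.
have {}fP l : [/\ block_pow (t l) n (a l).+1 (b l) (c l),
    forall e, block_pow (t l) n e (b l) (c l) -> (a l < e)%N,
    block_pow (t l) n (a l) (b l) (c l).+1 &
    ~~ free_at (t l) n -> block_pow (t l) n (a l) (b l).+1 (c l)].
  by have := fP l; rewrite /a /b /c; case: (f l) => [[]].
(* Block [l] needs the share [(a l).+1], so the exponent of [x] is one short of the total. Any
   variable that lowers the demand of one block to [a l] closes the gap. *)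
pose mu := mnm_xyz (n.-1 + \sum_l (a l).+1) b c.
have drop i l : (i = var_y l \/ i = var_z l) ->
    block_pow (t l) n (a l) ((mu + U_(i))%MM (var_y l)) ((mu + U_(i))%MM (var_z l)) ->
  power_pred n (mu + U_(i))%MM.
  move=> il Bl; exists (fun l' => if l' == l then a l else (a l').+1).
    rewrite mnmDE mnm_xyzE (bigD1 l) //= eqxx [X in (_ <= _ + X + _)%N](bigD1 l) //=.
    rewrite (eq_bigr (fun l' => (a l').+1)) => [|l' /negbTE -> //].
    by move: (\sum_(_ | _) _)%N => X; lia.
  move=> l'; case: eqP => [->//|_].
  by apply: block_pow_le (let: And4 h _ _ _ := fP l' in h); rewrite // mnmDE mnm_xyzE leq_addr.
exists mu.
  case=> e; rewrite mnm_xyzE => ex eB.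
  have : (\sum_l (a l).+1 <= \sum_l e l)%N.
    apply: leq_sum => l _; case: (fP l) => _ h _ _; apply: h.
    by have := eB l; rewrite !mnm_xyzE.
  by move: ex; move: (\sum_l _)%N (\sum_l e l)%N => X Y; lia.
move=> i; case: (varP i) => [|l|l] iT.
- exists (fun l => (a l).+1).
    by rewrite mnmDE mnm_xyzE mnm1E eqxx addnAC addn1 prednK.
  move=> l; apply: block_pow_le (let: And4 h _ _ _ := fP l in h); rewrite // mnmDE mnm_xyzE leq_addr //.
- have lT : ~~ free_at (t l) n.
    by apply: contra iT => fl; rewrite map_f // mem_filter fl mem_enum.
  apply: (drop _ l); first by left.
  case: (fP l) => _ _ _ /(_ lT); apply: block_pow_le => //.
    by rewrite mnmDE mnm_xyzE mnm1E eqxx addn1.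
  by rewrite mnmDE mnm_xyzE leq_addr.
- apply: (drop _ l); first by right.
  case: (fP l) => _ _ + _; apply: block_pow_le => //.
    by rewrite mnmDE mnm_xyzE leq_addr.
  by rewrite mnmDE mnm_xyzE mnm1E eqxx addn1.
Qed.

Theorem depth_generators_pow n : (0 < n)%N ->
  depth_quot_eq (ideal_pow (@monomial_ideal k m generators) n) (size (free_blocks n)).
Proof.
move=> n0; rewrite generators_pow; have uP := @power_pred_up n; split.
  exists (differences k var_y var_z (free_blocks n)); split; first by rewrite size_map.
  apply: (@regular_differences k _ _ var_x) => //.
  - exact: var_y_inj.
  - exact: var_z_inj.
  - exact: var_yz.
  - by rewrite filter_uniq // enum_uniq.
  - by move=> l; rewrite mem_filter => /andP[nl _]; apply: power_pred_meet.
  - by move=> w wx [e ex _]; lia.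
move=> s [sm [sreg _]]; have [mu nmu muP] := power_pred_socle n0.
rewrite -(size_map var_y); apply: (weakly_regular_size_le uP nmu muP).
  by apply: weakly_regularP => //; apply: supp_ideal_ideal.
by move=> p /(nthP 0)[i si <-]; apply: sm.
Qed.

End Construction.

(** * The thresholds of [f] and the final count *)

Lemma exists_thresholds (f : nat -> nat) :
  (forall n, (0 < n)%N -> (f n.+1 <= f n)%N) ->
  exists t : 'I_(f 1%N) -> nat, forall l, (0 < t l)%N /\
    forall n, (0 < n)%N -> free_at (t l) n = (l < f n)%N.
Proof.
move=> hf; apply: (fin_all_exists (P := fun (l : 'I_(f 1%N)) t =>
  (0 < t)%N /\ forall n, (0 < n)%N -> free_at t n = (l < f n)%N)) => l.
have mono i j : (0 < i)%N -> (f (i + j) <= f i)%N.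
  move=> i0; elim: j => [|j IHj]; rewrite ?addn0 // addnS.
  by apply: leq_trans IHj; apply: hf; rewrite addn_gt0 i0.
case: (classic (exists n, (0 < n)%N && (f n <= l)%N)) => [ex|nex].
  case: (ex_minnP ex) => t /andP[t0 ft] tmin; exists t; split=> // n n0.
  (* Since $l < f(1)$, a genuine threshold is never 1, which leaves 1 for the case where [f] never
     drops to [l]. *)
  have t1 : t != 1%N by apply: contraTneq ft => ->; rewrite -ltnNge.
  rewrite /free_at (negbTE t1) orbF [RHS]ltnNge; case: ltnP => nt.
    by apply/esym/negP => fn; have := tmin n; rewrite n0 fn leqNgt nt => /(_ isT).
  by apply/esym/negbF; apply: leq_trans ft; rewrite -(subnKC nt) mono.
exists 1%N; split=> // n n0; rewrite /free_at eqxx orbT; apply/esym; rewrite ltnNge; apply/negP => fn.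
by apply: nex; exists n; rewrite n0.
Qed.

Theorem theorem4p9 (k : fieldType) (f : nat -> nat)
  (hf : forall n : nat, (0 < n)%N -> (f (S n) <= f n)%N) :
  exists (m : nat) (G : seq (monom m)),
    forall n : nat, (0 < n)%N ->
      depth_quot_eq (ideal_pow (@monomial_ideal k m G) n) (f n).
Proof.
have [t tP] := exists_thresholds hf.
exists (f 1%N + f 1%N).+1, (generators t) => n n0.
suff <- : size (free_blocks t n) = f n.
  by apply: depth_generators_pow => // l; case: (tP l).
have fn1 : (f n <= f 1)%N.
  elim: n n0 => [//|[|n] IHn] _ //.
  by apply: leq_trans (hf _ _) (IHn _).
(* Both sides count the $l < f(1)$ with $l < f(n)$. *)
rewrite -[RHS](sum_ltn fn1) size_filter -sum1_count big_mkcond big_enum /=.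
by apply: eq_bigr => l _; case: (tP l) => _ -> //; case: ltnP.
Qed.
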